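(* Let $X$ be a metric space and let $m\ge 0$ be an integer. Then the following are equivalent: (a) For any $\epsilon>0$ there is $\delta$ with $\epsilon>\delta>0$ such that for every subset $A$ of $X$, any $(\delta,\delta)$-Lipschitz function $f\colon A\to S^m$ extends to an $(\epsilon,\epsilon)$-Lipschitz function $\tilde f\colon X\to S^m$. (b) For any $s>0$ there is $t>s$ such that for any finite $(m+2)$-element cover $\mathcal U=\{U_0,\ldots,U_{m+1}\}$ of $X$ with Lebesgue number greater than $t$ there is a refinement $\mathcal V$ of $\mathcal U$ such that $\mathcal V$ has Lebesgue number greater than $s$ and the dimension of $\mathcal V$ is at most $m$.
   Context: A function $f\colon(X,d_X)\to(Y,d_Y)$ of metric spaces is $(\lambda,C)$-Lipschitz if $d_Y(f(x),f(x'))\le\lambda\, d_X(x,x')+C$ for all $x,x'\in X$. $S^m$ denotes the boundary $\partial\Delta^{m+1}$ of the standard unit $(m+1)$-simplex with the $\ell_1$-metric (bi-Lipschitz equivalent to the unit sphere of $\mathbb R^{m+1}$). Covers consist of arbitrary subsets. A refinement of a cover $\mathcal U$ of $X$ is a cover $\mathcal V$ of $X$ each of whose elements is contained in some element of $\mathcal U$. $\dim(\mathcal V)\le m$ means each $x\in X$ lies in at most $m+1$ elements of $\mathcal V$. The Lebesgue number of a cover $\mathcal U$ is the supremum of all $r\ge0$ such that every ball $B(x,r)$ is contained in some element of $\mathcal U$. *)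

(* Defs.v *)
From HB Require Import structures.
From mathcomp Require Import all_boot all_order all_algebra.
From mathcomp Require Import all_classical all_reals all_analysis.

Set Implicit Arguments.
Unset Strict Implicit.
Unset Printing Implicit Defensive.

Import Order.TTheory GRing.Theory Num.Theory.
Import numFieldNormedType.Exports.
Local Open Scope classical_set_scope.
Local Open Scope card_scope.
Local Open Scope ring_scope.

(* [affine_lipschitz_on] only looks at the values of [f] on [A], so a total function
   stands for a function defined on the subspace [A] (nothing is lost when the
   codomain is inhabited). *)
Definition affine_lipschitz_on (R : realType) (X Y : metricType R)
    (lam C : R) (A : set X) (f : X -> Y) : Prop :=
  forall x x', A x -> A x' -> mdist (f x) (f x') <= lam * mdist x x' + C.

Definition affine_lipschitz (R : realType) (X Y : metricType R)
    (lam C : R) (f : X -> Y) : Prop :=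
  affine_lipschitz_on lam C setT f.

Definition std_simplex (R : realType) (n : nat) : pred 'rV[R]_n.+1 :=
  fun x => [forall i, 0 <= x 0 i] && (\sum_i x 0 i == 1).

(* The union of the proper faces of the simplex. *)
Definition std_simplex_boundary (R : realType) (n : nat) : pred 'rV[R]_n.+1 :=
  fun x => std_simplex x && [exists i, x 0 i == 0].

Record sphere (R : realType) (m : nat) : Type := Sphere {
  sphere_val :> 'rV[R]_m.+2 ;
  sphere_valP : std_simplex_boundary sphere_val }.

HB.instance Definition _ (R : realType) (m : nat) :=
  [isSub for @sphere_val R m].
HB.instance Definition _ (R : realType) (m : nat) :=
  [Choice of sphere R m by <:].

Section sphere_metric.
Variables (R : realType) (m : nat).
Implicit Types x y z : sphere R m.

Definition l1_dist x y : R :=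
  \sum_i `|sphere_val x 0 i - sphere_val y 0 i|.

Lemma l1_distxx x : l1_dist x x = 0.
Proof. by rewrite /l1_dist big1// => i _; rewrite subrr normr0. Qed.

Lemma l1_dist_positivity x y : l1_dist x y = 0 -> x = y.
Proof.
move=> /psumr_eq0P xy0; apply/val_inj/rowP => i /=.
by apply/eqP; rewrite -subr_eq0 -normr_eq0; apply/eqP/xy0.
Qed.

Lemma l1_dist_sym x y : l1_dist x y = l1_dist y x.
Proof. by apply: eq_bigr => i _; rewrite distrC. Qed.

Lemma l1_dist_triangle y x z : l1_dist x z <= l1_dist x y + l1_dist y z.
Proof. by rewrite -big_split; apply: ler_sum => i _; exact: ler_distD. Qed.

HB.instance Definition _ := isMetric.Build R (sphere R m)
  l1_distxx l1_dist_positivity l1_dist_sym l1_dist_triangle.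

End sphere_metric.

(* A cover is a set of arbitrary subsets; [cover] is the library's union of a
   family, here indexed by its own members. *)
Definition is_cover (X : Type) (U : set (set X)) : Prop :=
  cover U id = [set: X].

Definition is_refinement (X : Type) (U V : set (set X)) : Prop :=
  is_cover V /\ forall W, V W -> exists2 W', U W' & W `<=` W'.

Definition cover_dim_le (X : Type) (V : set (set X)) (m : nat) : Prop :=
  forall x, [set W | V W /\ W x] #<= `I_m.+1.

(* Possibly [+oo]. Library balls are open; closed balls would give the same
   supremum on covers. *)
Definition lebesgue_number (R : realType) (X : metricType R)
    (U : set (set X)) : \bar R :=
  ereal_sup [set r%:E | r in
    [set r : R | 0 <= r /\ forall x, exists2 W, U W & ball x r `<=` W]].

(* Main.v *)
(** (a) => (b).  A partition of unity [phi] subordinate to [U] maps the set [A]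
    of points where some coordinate vanishes to the sphere.  Let [F] extend it.
    The sets [F_i > 0] have large Lebesgue number and no point lies in all of
    them.  They refine [U]: on [A], [F = phi]; off [A], every [phi_i] is
    positive, so the point lies in every [U_i].

    (b) => (a).  Extend the coordinates of [f] to Lipschitz functions [h_i], put
    [k_i = max(0, h_i - c)] and refine the cover by the sets [k_i > 0]; a
    partition of unity [phi] subordinate to the refinement takes values in the
    sphere.  Interpolate between normalized [k] near [A] and [phi] far from [A].
    Near [A] some [h_i] is at most [c], hence [k_i = 0] and [phi_i = 0], so the
    interpolation stays in the sphere.  On [A] it is within [eps] of [f], and
    the additive constant allows replacing it by [f] there. *)
Require Import Defs.
From mathcomp Require Import all_boot all_order all_algebra.
From mathcomp Require Import all_classical all_reals all_analysis.
From mathcomp Require Import ring lra.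

Set Implicit Arguments.
Unset Strict Implicit.
Unset Printing Implicit Defensive.

Import Order.TTheory GRing.Theory Num.Theory.
Import numFieldNormedType.Exports.
Local Open Scope classical_set_scope.
Local Open Scope ring_scope.

(** * Lebesgue numbers and dimension of covers *)

Lemma lebesgue_number_gt (R : realType) (X : metricType R) (U : set (set X))
    (s r : R) :
  0 <= s -> s < r -> (forall x, exists2 W, U W & ball x r `<=` W) ->
  (s%:E < lebesgue_number U)%E.
Proof.
move=> s0 sr Ur; apply: (@lt_le_trans _ _ r%:E); first by rewrite lte_fin.
by apply: ereal_sup_ubound; exists r => //; split => //; lra.
Qed.

Lemma ball_sub_of_lebesgue_number (R : realType) (X : metricType R)
    (U : set (set X)) (s : R) (x : X) :
  (s%:E < lebesgue_number U)%E -> exists2 W, U W & ball x s `<=` W.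
Proof.
move=> /ereal_sup_gt[_ [r [_ Ur] <-]]; rewrite lte_fin => sr.
have [W UW rW] := Ur x; exists W => //.
exact: subset_trans (le_ball (ltW sr)) rW.
Qed.

(** The members containing [x] all have an index other than [i0], and [lift i0] enumerates these
    [m.+1] indices. Bounding by an image allows [V] to repeat sets. *)
Lemma cover_dim_le_range (T : Type) (m : nat) (V : 'I_m.+2 -> set T) :
  (forall x, exists i, ~ V i x) -> cover_dim_le (range V) m.
Proof.
move=> Vx x; have [i0 Vi0] := Vx x.
apply: (card_le_trans _ (card_image_le (fun k => V (lift i0 (inord k))) _)).
apply: subset_card_le => _ [[i _ <-] Vi].
have : i0 != i by apply/eqP => i0i; apply: Vi0; rewrite i0i.
move=> /unlift_some[j -> _]; exists (val j); first exact: ltn_ord.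
by rewrite inord_val.
Qed.

(** Pigeonhole: at most [m.+1] members contain [x], so their labels cannot exhaust [m.+2] values. *)
Lemma cover_dim_le_missing_label (T : Type) (m : nat) (V : set (set T))
    (lbl : set T -> 'I_m.+2) (x : T) :
  cover_dim_le V m -> exists i, forall W, V W -> W x -> lbl W <> i.
Proof.
move=> /(_ x) Vm; apply: contrapT => /forallNP noi.
have : (`I_m.+2 #<= `I_m.+1)%card.
  apply: card_le_trans Vm.
  apply: (card_le_trans _ (card_image_le (fun W => lbl W : nat) _)).
  apply: subset_card_le => k /= km.
  have /existsNP[W /not_implyP[VW /not_implyP[Wx /contrapT lW]]] :=
    noi (Ordinal km).
  by exists W => //; rewrite lW.
by rewrite card_le_II ltnn.
Qed.

(** * Maps into the sphere, described by their coordinates *)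

Lemma sphere_mapP (R : realType) (m : nat) (X : Type) (v : X -> 'I_m.+2 -> R) :
  (forall x i, 0 <= v x i) -> (forall x, \sum_i v x i = 1) ->
  (forall x, exists i, v x i = 0) ->
  exists F : X -> sphere R m, forall x i, sphere_val (F x) 0 i = v x i.
Proof.
move=> v0 v1 vb.
suff : forall x, exists p : sphere R m, forall i, sphere_val p 0 i = v x i.
  by move=> /choice[F vF]; exists F.
move=> x; have [i0 vi0] := vb x.
have bp : std_simplex_boundary (\row_i v x i).
  apply/andP; split; last by apply/existsP; exists i0; rewrite mxE vi0.
  apply/andP; split; first by apply/forallP => i; rewrite mxE.
  by under eq_bigr do rewrite mxE; apply/eqP.
by exists (Sphere bp) => i /=; rewrite mxE.
Qed.

Lemma sphere_coord_ge0 (R : realType) (m : nat) (p : sphere R m) i :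
  0 <= sphere_val p 0 i.
Proof. by case: p => v /= /andP[/andP[/forallP]]. Qed.

Lemma sphere_coord_sum (R : realType) (m : nat) (p : sphere R m) :
  \sum_i sphere_val p 0 i = 1.
Proof. by case: p => v /= /andP[/andP[_ /eqP]]. Qed.

Lemma sphere_coord_eq0 (R : realType) (m : nat) (p : sphere R m) :
  exists i, sphere_val p 0 i = 0.
Proof. by case: p => v /= /andP[_ /existsP[i /eqP]]; exists i. Qed.

Lemma sphere_coord_dist (R : realType) (m : nat) (p q : sphere R m) i :
  sphere_val p 0 i - sphere_val q 0 i <= mdist p q.
Proof.
apply: (le_trans (ler_norm _)).
rewrite [leRHS](_ : _ = l1_dist p q)// /l1_dist (bigD1 i)//= lerDl.
exact: sumr_ge0.
Qed.

Lemma sphere_inhabited (R : realType) (m : nat) : exists p : sphere R m, True.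
Proof.
have [|_|_|F _] := @sphere_mapP R m unit (fun _ i => (i == ord0)%:R).
- by move=> _ i; rewrite ler0n.
- by rewrite -natr_sum (bigD1 ord0)//= big1 => // i /negbTE ->.
- by exists ord_max.
- by exists (F tt).
Qed.

(** * Normalization onto the simplex *)

Lemma exists_ge_average (R : realType) (n : nat) (v : 'I_n.+1 -> R) (c : R) :
  c <= \sum_i v i -> exists i, c / n.+1%:R <= v i.
Proof.
move=> cv; apply: contrapT => /forallNP noi.
have : \sum_i v i < \sum_(i < n.+1) c / n.+1%:R.
  apply: ltr_sum => [|i _]; first by apply/hasP; exists ord0; rewrite ?mem_index_enum.
  by rewrite ltNge; apply/negP/noi.
rewrite sumr_const card_ord -[ltRHS]mulr_natr divfK ?pnatr_eq0//.
by rewrite ltNge cv.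
Qed.

Definition normalize (R : realType) (n : nat) (k : 'I_n -> R) (i : 'I_n) : R :=
  k i / \sum_j k j.

Lemma normalize_ge0 (R : realType) (n : nat) (k : 'I_n -> R) i :
  (forall i, 0 <= k i) -> 0 <= normalize k i.
Proof. by move=> k0; rewrite divr_ge0// sumr_ge0. Qed.

Lemma normalize_sum (R : realType) (n : nat) (k : 'I_n -> R) :
  0 < \sum_i k i -> \sum_i normalize k i = 1.
Proof. by move=> k0; rewrite -mulr_suml divff// gt_eqF. Qed.

(** With sums [K] and [K'], the difference of the [i]-th coordinates is [(k i - k' i) / K + k' i /
    K' * ((K' - K) / K)]. Since [K'] differs from [K] by at most the l1-distance of [k] and [k'],
    each of the two terms contributes at most that distance over [mu]. *)
Lemma normalize_dist (R : realType) (n : nat) (k k' : 'I_n -> R) (mu : R) :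
  0 < mu -> mu <= \sum_i k i -> 0 < \sum_i k' i -> (forall i, 0 <= k' i) ->
  \sum_i `|normalize k i - normalize k' i| <= 2 * (\sum_i `|k i - k' i|) / mu.
Proof.
rewrite /normalize; set K := \sum_i k i; set K' := \sum_i k' i => mu0 muK K'0 k'0.
set S := \sum_i `|k i - k' i|.
have K0 : 0 < K by apply: lt_le_trans muK.
have SKK' : `|K' - K| <= S.
  by rewrite distrC /K /K' -sumrB; exact: ler_norm_sum.
have S0 : 0 <= S by apply: sumr_ge0.
apply: (@le_trans _ _ (\sum_i (`|k i - k' i| / K + k' i / K' * (`|K' - K| / K)))).
  apply: ler_sum => i _.
  have -> : k i / K - k' i / K' = (k i - k' i) / K + k' i / K' * ((K' - K) / K).
    by field; rewrite !gt_eqF.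
  apply: (le_trans (ler_normD _ _)); rewrite !normrM !normfV.
  by rewrite (ger0_norm (k'0 i)) (gtr0_norm K0) (gtr0_norm K'0).
rewrite big_split/= -!mulr_suml -/S -/K' divff ?gt_eqF// mul1r -mulrDl.
apply: (@le_trans _ _ (2 * S / K)).
  by rewrite ler_pM2r ?invr_gt0//; lra.
by rewrite ler_wpM2l ?lef_pV2 ?posrE//; lra.
Qed.

Lemma normalize_lipschitz (R : realType) (X : metricType R) (n : nat)
    (k : X -> 'I_n -> R) (lam mu : R) :
  0 < mu -> (forall x i, 0 <= k x i) -> (forall x, mu <= \sum_i k x i) ->
  (forall i x y, `|k x i - k y i| <= lam * mdist x y) ->
  forall x y, \sum_i `|normalize (k x) i - normalize (k y) i| <=
    2 * n%:R * lam / mu * mdist x y.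
Proof.
move=> mu0 k0 kmu klam x y.
apply: (le_trans (normalize_dist mu0 _ _ _)) => //.
  exact: lt_le_trans (kmu y).
have -> : 2 * n%:R * lam / mu * mdist x y =
    2 * (\sum_(i < n) lam * mdist x y) / mu.
  by rewrite sumr_const card_ord -mulr_natl; ring.
by rewrite ler_pM2r ?invr_gt0// ler_pM2l//; exact: ler_sum.
Qed.

(** * Lipschitz real functions and partitions of unity *)

Lemma lipschitz_of_le (R : realType) (X : metricType R) (h : X -> R) (lam : R) :
  (forall x y, h x <= h y + lam * mdist x y) ->
  forall x y, `|h x - h y| <= lam * mdist x y.
Proof.
move=> hle x y; have := hle x y; have := hle y x.
by rewrite (metric_sym y x) ler_norml => *; lra.
Qed.

Lemma lipschitz_pos_part (R : realType) (X : metricType R) (h : X -> R)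
    (lam c : R) :
  (forall x y, `|h x - h y| <= lam * mdist x y) ->
  forall x y, `|Num.max 0 (h x - c) - Num.max 0 (h y - c)| <= lam * mdist x y.
Proof.
move=> hlam; apply: lipschitz_of_le => x y.
have := hlam x y; rewrite ler_norml => /andP[_ hxy].
have d0 : 0 <= lam * mdist x y by apply: le_trans (hlam x y).
by rewrite ge_max !maxEle; case: ifPn; rewrite -?ltNge => *; lra.
Qed.

(** The distance from [x] to the complement of [W], truncated at [t] so that the supremum is finite
    even when [W] is the whole space. Open balls of radius 0 are empty, so 0 always qualifies as a
    radius. *)
Definition inner_radius (R : realType) (X : metricType R) (t : R) (W : set X)
    (x : X) : R :=
  sup [set r : R | [/\ 0 <= r, r <= t & ball x r `<=` W]].

Lemma le_inner_radius (R : realType) (X : metricType R) (t : R) (W : set X)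
    (x : X) (r : R) :
  0 <= r -> r <= t -> ball x r `<=` W -> r <= inner_radius t W x.
Proof. by move=> r0 rt rW; apply: ub_le_sup => //; exists t => s []. Qed.

Lemma inner_radius_ge0 (R : realType) (X : metricType R) (t : R) (W : set X)
    (x : X) :
  0 <= t -> 0 <= inner_radius t W x.
Proof.
move=> t0; apply: le_inner_radius => //.
by rewrite ballEmdist => y /= /lt_geF; rewrite mdist_ge0.
Qed.

(** The ball of radius [r] around [x] contains the ball of radius [r - mdist x y] around [y]; when
    that radius is not positive, nonnegativity suffices. *)
Lemma inner_radius_lipschitz (R : realType) (X : metricType R) (t : R)
    (W : set X) :
  0 <= t ->
  forall x y, `|inner_radius t W x - inner_radius t W y| <= 1 * mdist x y.
Proof.
move=> t0; apply: lipschitz_of_le => x y; rewrite mul1r.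
apply: ge_sup.
  exists 0; split => //.
  by rewrite ballEmdist => z /= /lt_geF; rewrite mdist_ge0.
move=> r [r0 rt rW]; have d0 := mdist_ge0 x y.
have [rd|/ltW rd] := leP r (mdist x y).
  by have := inner_radius_ge0 W y t0; lra.
rewrite -lerBlDr; apply: le_inner_radius; [lra|lra|].
apply: subset_trans rW; rewrite !ballEmdist => z /= yz.
by have := metric_triangle x y z; lra.
Qed.

Lemma inner_radius_gt0 (R : realType) (X : metricType R) (t : R) (W : set X)
    (x : X) :
  0 <= t -> 0 < inner_radius t W x -> W x.
Proof.
move=> t0 /sup_gt[|r [r0 _ rW] rgt0]; last first.
  by apply: rW; rewrite ballEmdist/= mdistxx.
exists 0; split => //.
by rewrite ballEmdist => z /= /lt_geF; rewrite mdist_ge0.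
Qed.

(** Normalized inner radii: each is 1-Lipschitz, and their sum is at least [t] because the one for a
    set containing [ball x t] reaches the truncation. *)
Lemma subordinate_partition (R : realType) (X : metricType R) (n : nat)
    (U : 'I_n -> set X) (t : R) :
  0 < t -> (forall x, exists i, ball x t `<=` U i) ->
  exists phi : X -> 'I_n -> R,
    [/\ forall x i, 0 <= phi x i, forall x, \sum_i phi x i = 1,
        forall x i, phi x i != 0 -> U i x &
        forall x y, \sum_i `|phi x i - phi y i| <= 2 * n%:R / t * mdist x y].
Proof.
move=> t0 Ut; pose psi x i := inner_radius t (U i) x.
have psi0 x i : 0 <= psi x i by apply: inner_radius_ge0; exact: ltW.
have psit x : t <= \sum_i psi x i.
  have [i xi] := Ut x.
  rewrite (bigD1 i)//= -[leLHS]addr0 lerD//; last exact: sumr_ge0.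
  by apply: le_inner_radius => //; exact: ltW.
exists (fun x => normalize (psi x)); split.
- by move=> x i; exact: normalize_ge0.
- by move=> x; apply: normalize_sum; exact: lt_le_trans (psit x).
- move=> x i; rewrite /normalize mulf_eq0 negb_or => /andP[psixi _].
  by apply: (@inner_radius_gt0 _ _ t); rewrite ?ltW// lt_def psixi psi0.
- move=> x y; have := @normalize_lipschitz _ _ _ psi 1 t t0 psi0 psit.
  rewrite mulr1; apply => i x' y'.
  by apply: inner_radius_lipschitz; exact: ltW.
Qed.

(** * McShane's extension formula *)

(** For an [f] that is Lipschitz only up to an additive constant this need not restrict to [f] on
    [A]. With [f = 0] and [lam = 1] it is the distance to [A]. *)
Definition mcshane (R : realType) (X : metricType R) (A : set X) (lam : R)
    (f : X -> R) (x : X) : R :=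
  inf [set f a + lam * mdist x a | a in A].

Lemma mcshane_le (R : realType) (X : metricType R) (A : set X) (lam : R)
    (f : X -> R) (x a : X) :
  0 <= lam -> (forall a, 0 <= f a) -> A a ->
  mcshane A lam f x <= f a + lam * mdist x a.
Proof.
move=> lam0 f0 Aa; apply: ge_inf; last by exists a.
by exists 0 => _ [b _ <-]; rewrite addr_ge0// mulr_ge0// mdist_ge0.
Qed.

Lemma le_mcshane (R : realType) (X : metricType R) (A : set X) (lam : R)
    (f : X -> R) (x : X) (c : R) :
  A !=set0 -> (forall a, A a -> c <= f a + lam * mdist x a) ->
  c <= mcshane A lam f x.
Proof.
move=> [a0 Aa0] cle; apply: lb_le_inf; first by exists (f a0 + lam * mdist x a0), a0.
by move=> _ [a Aa <-]; exact: cle.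
Qed.

Lemma mcshane_lipschitz (R : realType) (X : metricType R) (A : set X) (lam : R)
    (f : X -> R) :
  0 <= lam -> (forall a, 0 <= f a) -> A !=set0 ->
  forall x y, `|mcshane A lam f x - mcshane A lam f y| <= lam * mdist x y.
Proof.
move=> lam0 f0 A0; apply: lipschitz_of_le => x y.
rewrite -lerBlDr; apply: le_mcshane => // a Aa; rewrite lerBlDr.
apply: (le_trans (mcshane_le x lam0 f0 Aa)).
by rewrite -addrA lerD2l -mulrDr ler_wpM2l// addrC metric_triangle.
Qed.

Lemma mcshane_lt (R : realType) (X : metricType R) (A : set X) (lam : R)
    (f : X -> R) (x : X) (c : R) :
  A !=set0 -> mcshane A lam f x < c ->
  exists2 a, A a & f a + lam * mdist x a < c.
Proof.
move=> [a0 Aa0] /inf_lt[|_ [a Aa <-] ac]; last by exists a.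
by exists (f a0 + lam * mdist x a0), a0.
Qed.

(** * From extension of maps to refinement of covers *)

(** The bound on [2 * m.+2%:R / t] makes the partition of unity [delta]-Lipschitz. Some coordinate
    of [F x] is at least [m.+2%:R^-1]; on a ball of radius [s + 1] it drops by at most
    [eps * (s + 1) + eps], hence stays positive. *)
Lemma refinement_of_extension (R : realType) (X : metricType R) (m : nat)
    (s eps delta t : R) (U : 'I_m.+2 -> set X) :
  0 < s -> 0 < eps -> eps * (s + 2) < m.+2%:R^-1 -> 0 < delta ->
  0 < t -> 2 * m.+2%:R / t <= delta ->
  (forall (A : set X) (f : X -> sphere R m),
     affine_lipschitz_on delta delta A f ->
     exists g : X -> sphere R m,
       affine_lipschitz eps eps g /\ (forall x, A x -> g x = f x)) ->
  (t%:E < lebesgue_number (range U))%E ->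
  exists V : set (set X),
    [/\ is_refinement (range U) V, (s%:E < lebesgue_number V)%E &
        cover_dim_le V m].
Proof.
move=> s0 eps0 epss delta0 t0 tdelta ext Ut.
have {}Ut x : exists i, ball x t `<=` U i.
  by have [_ [i _ <-]] := ball_sub_of_lebesgue_number x Ut; exists i.
have [phi [phi0 phi1 phiU philip]] := subordinate_partition t0 Ut.
pose A := [set x | exists i, phi x i = 0].
have [p0 _] := sphere_inhabited R m.
(* The value [p0] off [A] is a mere default: the Lipschitz condition on [A] does not see it. *)
pose v x i := if pselect (A x) then phi x i else sphere_val p0 0 i.
have [||| f fv] := @sphere_mapP R m X v.
- by move=> x i; rewrite /v; case: pselect => [Ax|nAx] //=; exact: sphere_coord_ge0.
- by move=> x; rewrite /v; case: pselect => [Ax|nAx] //=; exact: sphere_coord_sum.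
- by move=> x; rewrite /v; case: pselect => [Ax|nAx] //=; exact: sphere_coord_eq0.
have fphi x i : A x -> sphere_val (f x) 0 i = phi x i.
  by move=> Ax; rewrite fv /v; case: pselect.
have [x y Ax Ay|F [Flip Ff]] := ext A f.
  rewrite [leLHS](_ : _ = \sum_i `|phi x i - phi y i|); last first.
    by apply: eq_bigr => i _; rewrite !fphi.
  apply: (le_trans (philip x y)).
  have := ler_wpM2r (mdist_ge0 x y) tdelta; lra.
pose V i := [set x | 0 < sphere_val (F x) 0 i].
have VU i : V i `<=` U i.
  move=> x Vx; apply: phiU; apply/eqP => phixi.
  have Ax : A x by exists i.
  by move: Vx; rewrite /V/= Ff// fphi// phixi ltxx.
(* Radius [s + 1] rather than [s], since the Lebesgue number must exceed [s] strictly. *)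
have sV x : exists2 W, range V W & ball x (s + 1) `<=` W.
  have [i Fi] : exists i, 1 / m.+2%:R <= sphere_val (F x) 0 i.
    by apply: exists_ge_average; rewrite sphere_coord_sum.
  exists (V i); first by exists i.
  rewrite ballEmdist => y /= xy.
  have := sphere_coord_dist (F x) (F y) i; have := Flip x y I I.
  have : eps * mdist x y <= eps * (s + 1) by rewrite ler_pM2l// ltW.
  rewrite /V/=; move: Fi epss; rewrite div1r; set iN := (_^-1); lra.
exists (range V); split.
- split; last by move=> _ [i _ <-]; exists (U i) => //; exists i.
  apply/seteqP; split => // x _; have [W VW xW] := sV x.
  by exists W => //; apply: xW; rewrite ballEmdist/= mdistxx; lra.
- by apply: (@lebesgue_number_gt _ _ _ s (s + 1)) => //; lra.
- apply: cover_dim_le_range => x; have [i Fi] := sphere_coord_eq0 (F x).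
  by exists i; rewrite /V/= Fi ltxx.
Qed.

(** * From refinement of covers to extension of maps *)

(* McShane's extensions of the coordinates need not lie in the simplex, but
   their maximum stays bounded below: close to [A] because they almost agree
   with [f] on [A], and far from [A] because they grow with the distance. *)
Lemma coordinate_extension (R : realType) (X : metricType R) (m : nat)
    (delta : R) (A : set X) (f : X -> sphere R m) :
  0 < delta -> delta <= (4 * m.+2%:R)^-1 -> A !=set0 ->
  affine_lipschitz_on delta delta A f ->
  exists h : X -> 'I_m.+2 -> R,
    [/\ forall i x y, `|h x i - h y i| <= delta * mdist x y,
        forall x i a, A a ->
          h x i <= sphere_val (f a) 0 i + delta * mdist x a,
        forall i a, A a -> sphere_val (f a) 0 i - delta <= h a i &
        forall x, exists i, (4 * m.+2%:R)^-1 <= h x i].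
Proof.
move=> delta0 deltaN A0 flip; set N : R := m.+2%:R in deltaN *.
have N0 : 0 < N by rewrite ltr0n.
pose fi i a := sphere_val (f a) 0 i.
have fi0 i a : 0 <= fi i a by exact: sphere_coord_ge0.
pose h x i := mcshane A delta (fi i) x.
have hlip i x y : `|h x i - h y i| <= delta * mdist x y.
  by apply: mcshane_lipschitz => //; exact: ltW.
have hge i a : A a -> fi i a - delta <= h a i.
  move=> Aa; apply: le_mcshane => // b Ab.
  have := flip _ _ Aa Ab; have := sphere_coord_dist (f a) (f b) i.
  rewrite /fi; lra.
exists h; split => //.
  by move=> x i a Aa; apply: mcshane_le => //; exact: ltW.
have invN : 0 < N^-1 by rewrite invr_gt0.
move: deltaN; rewrite invfM => deltaN x; set iN := N^-1 in invN deltaN *.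
(* At distance [D] the slope [delta] accounts for [iN / 2]. Closer to [A], a coordinate of size [iN]
   loses at most [delta + iN / 2], which leaves [iN / 4]; farther away, the slope term alone exceeds
   [iN / 4] for every index, so [ord0] serves. *)
pose D := iN / 2 / delta.
have deltaD : delta * D = iN / 2 by rewrite /D mulrC divfK ?gt_eqF.
have [[a Aa xa]|far] := pselect (exists2 a, A a & mdist x a <= D).
  have [i fai] : exists i, 1 / N <= fi i a.
    by apply: exists_ge_average; rewrite sphere_coord_sum.
  exists i; have := hge i a Aa; have := hlip i a x.
  have := ler_norm (h a i - h x i).
  have : delta * mdist a x <= delta * D by rewrite ler_pM2l// metric_sym.
  rewrite deltaD; move: fai; rewrite div1r -/iN; lra.
exists ord0; apply: le_mcshane => // a Aa.
have xa : D <= mdist x a.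
  by rewrite leNgt; apply/negP => /ltW xa; apply: far; exists a.
have : delta * D <= delta * mdist x a by rewrite ler_pM2l.
have := fi0 ord0 a; rewrite deltaD; lra.
Qed.

(** Each member of [V] is labelled by some [U i] containing it, and members with equal labels are
    united into [V' i]. At each point some label is missing among the members through it, so the
    corresponding coordinate of [phi] vanishes. *)
Lemma sphere_partition_of_refinement (R : realType) (X : metricType R)
    (m : nat) (s : R) (U : 'I_m.+2 -> set X) (V : set (set X)) :
  0 < s -> is_refinement (range U) V -> (s%:E < lebesgue_number V)%E ->
  cover_dim_le V m ->
  exists phi : X -> 'I_m.+2 -> R,
    [/\ forall x i, 0 <= phi x i, forall x, \sum_i phi x i = 1,
        forall x i, phi x i != 0 -> U i x,
        forall x, exists i, phi x i = 0 &
        forall x y, \sum_i `|phi x i - phi y i| <=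
          2 * m.+2%:R / s * mdist x y].
Proof.
move=> s0 [_ VU] sV dimV.
have /choice[lbl lblP] : forall W, exists i, V W -> W `<=` U i.
  move=> W; have [/VU[_ [i _ <-] WU]|nVW] := pselect (V W); first by exists i.
  (* Sets outside [V] get an arbitrary label. *)
  by exists ord0 => VW.
pose V' i := [set x | exists W, [/\ V W, lbl W = i & W x]].
have [x|phi [phi0 phi1 phiV' philip]] := subordinate_partition s0 (U := V').
  have [W VW xW] := ball_sub_of_lebesgue_number x sV.
  by exists (lbl W) => y /xW Wy; exists W.
exists phi; split => // [x i /phiV'[W [VW <- Wx]]|x]; first exact: lblP Wx.
have [i noi] := cover_dim_le_missing_label lbl x dimV.
exists i; apply/eqP/negPn/negP => /phiV'[W [VW lW Wx]].
exact: noi lW.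
Qed.

(** Each difference splits as [a * (p i - p' i) + (1 - a) * (q i - q' i) + (a - b) * (p' i - q' i)].
    The factor 2 is the total mass of [p'] and [q']. *)
Lemma convex_combination_dist (R : realType) (n : nat) (a b : R)
    (p p' q q' : 'I_n -> R) :
  0 <= a <= 1 -> (forall i, 0 <= p' i) -> (forall i, 0 <= q' i) ->
  \sum_i p' i = 1 -> \sum_i q' i = 1 ->
  \sum_i `|(a * p i + (1 - a) * q i) - (b * p' i + (1 - b) * q' i)| <=
    \sum_i `|p i - p' i| + \sum_i `|q i - q' i| + 2 * `|a - b|.
Proof.
move=> /andP[a0 a1] p'0 q'0 p'1 q'1.
have -> : 2 * `|a - b| = \sum_i `|a - b| * (p' i + q' i).
  by rewrite -mulr_sumr big_split/= p'1 q'1; ring.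
rewrite -!big_split/=; apply: ler_sum => i _.
have -> : a * p i + (1 - a) * q i - (b * p' i + (1 - b) * q' i) =
  a * (p i - p' i) + (1 - a) * (q i - q' i) + (a - b) * (p' i - q' i) by ring.
apply: (le_trans (ler_normD _ _)); apply: lerD.
  apply: (le_trans (ler_normD _ _)); rewrite !normrM.
  rewrite (ger0_norm a0) (ger0_norm (_ : 0 <= 1 - a)) ?subr_ge0//.
  by apply: lerD; rewrite ler_piMl//; lra.
rewrite normrM ler_wpM2l//; apply: (le_trans (ler_normB _ _)).
by rewrite !ger0_norm.
Qed.

(** The slope [eps] is shared equally: [s] gives [phi] slope [eps / 3], the bound
    [eps / (48 * m.+2%:R ^+ 2)] does so for normalized [k], and the cut-off [al] of slope [eps / 6]
    counts twice. The bounds on [c] keep normalized [k] within [eps] of [f] on [A] and the sum of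
    [k] at least [(8 * m.+2%:R)^-1]; the one on [delta * (t + 1)] gives the sets [U i] a large
    Lebesgue number. *)
Lemma extension_of_refinement (R : realType) (X : metricType R) (m : nat)
    (eps c delta s t : R) (A : set X) (f : X -> sphere R m) :
  0 < eps -> s = 6 * m.+2%:R / eps -> 0 < t ->
  0 < c -> c <= eps / (4 * m.+2%:R) -> c <= (8 * m.+2%:R)^-1 ->
  0 < delta -> delta <= c -> delta <= eps / (48 * m.+2%:R ^+ 2) ->
  delta * (6 / eps) <= c -> delta * (t + 1) < (8 * m.+2%:R)^-1 ->
  (forall U : 'I_m.+2 -> set X,
     is_cover (range U) -> (t%:E < lebesgue_number (range U))%E ->
     exists V : set (set X),
       [/\ is_refinement (range U) V, (s%:E < lebesgue_number V)%E &
           cover_dim_le V m]) ->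
  A !=set0 -> affine_lipschitz_on delta delta A f ->
  exists g : X -> sphere R m,
    affine_lipschitz eps eps g /\ (forall x, A x -> g x = f x).
Proof.
set N : R := m.+2%:R.
move=> eps0 sE t0 c0 ceps cN delta0 deltac deltaeps deltaL deltat refine A0 flip.
have N0 : 0 < N by rewrite ltr0n.
have NV0 : 0 < N^-1 by rewrite invr_gt0.
have s0 : 0 < s by rewrite sE divr_gt0// mulr_gt0.
move: cN deltat; rewrite !invfM => cN deltat.
have [|h [hlip hle hge hmax]] := coordinate_extension delta0 _ A0 flip.
  by rewrite -/N invfM; set iN := N^-1 in cN NV0 *; lra.
move: hmax; rewrite -/N invfM => hmax.
set iN := N^-1 in NV0 cN deltat hmax *.
pose k x i := Num.max 0 (h x i - c).
have klip i x y : `|k x i - k y i| <= delta * mdist x y.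
  by apply: (lipschitz_pos_part (h := h^~ i)).
have k0 x i : 0 <= k x i by rewrite le_max lexx.
have ksum x : (8 * N)^-1 <= \sum_i k x i.
  have [i hi] := hmax x.
  rewrite (bigD1 i)//= -[leLHS]addr0 lerD//; last exact: sumr_ge0.
  by rewrite invfM -/iN le_max; apply/orP; right; lra.
have N80 : 0 < (8 * N)^-1 by rewrite invr_gt0 mulr_gt0.
pose U i := [set x | c < h x i].
have tU x : exists2 W, range U W & ball x (t + 1) `<=` W.
  have [i hi] := hmax x; exists (U i); first by exists i.
  rewrite ballEmdist => y /= xy.
  have : delta * mdist x y <= delta * (t + 1) by rewrite ler_pM2l// ltW.
  have := hlip i x y; have := ler_norm (h x i - h y i); rewrite /U/=; lra.
have [||V [VU sV dimV]] := refine U.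
- apply/seteqP; split => // x _; have [W UW xW] := tU x.
  by exists W => //; apply: xW; rewrite ballEmdist/= mdistxx; lra.
- by apply: (@lebesgue_number_gt _ _ _ t (t + 1)) => //; lra.
have [phi [phi0 phi1 phiU phiz philip]] :=
  sphere_partition_of_refinement s0 VU sV dimV.
(* [d] is the distance to [A]. The cut-off [al] is 1 on [A] and vanishes from distance [6 / eps] on;
   within that distance a coordinate vanishing at a nearby point of [A] grows to at most
   [delta * (6 / eps) <= c]. *)
pose d x := mcshane A 1 (fun=> 0) x.
pose al x := Num.max 0 (1 - eps / 6 * d x).
have dlip x y : `|d x - d y| <= 1 * mdist x y by apply: mcshane_lipschitz.
have d0 x : 0 <= d x.
  by apply: le_mcshane => // a Aa; rewrite add0r mul1r mdist_ge0.
have al01 x : 0 <= al x <= 1.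
  rewrite le_max lexx ge_max ler01/= gerBl mulr_ge0//; lra.
have allip x y : `|al x - al y| <= eps / 6 * mdist x y.
  apply: lipschitz_of_le => {}x {}y.
  have := dlip y x; have := ler_norm (d y - d x).
  rewrite mul1r metric_sym => h1 h2.
  have := ler_wpM2l (_ : 0 <= eps / 6) (le_trans h1 h2).
  have : 0 <= eps / 6 * mdist x y by rewrite mulr_ge0 ?mdist_ge0//; lra.
  rewrite ge_max /al !maxEle; case: ifPn; rewrite -?ltNge => *; lra.
pose G x i := al x * normalize (k x) i + (1 - al x) * phi x i.
have khat0 x i : 0 <= normalize (k x) i by exact: normalize_ge0.
have khat1 x : \sum_i normalize (k x) i = 1.
  by apply: normalize_sum; exact: lt_le_trans (ksum x).
have Gz x : exists i, G x i = 0.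
  have [al0|al0] := eqVneq (al x) 0.
    by have [i phii] := phiz x; exists i; rewrite /G al0 phii; ring.
  have : d x < 6 / eps.
    rewrite ltNge; apply/negP => dx; move/eqP: al0; apply.
    apply/max_idPl; rewrite subr_le0.
    by rewrite mulrC -ler_pdivrMr ?divr_gt0// div1r invf_div.
  move=> /(mcshane_lt A0)[a Aa]; rewrite add0r mul1r => xa.
  have [i fai] := sphere_coord_eq0 (f a); exists i.
  have hc : h x i <= c.
    have := hle x i a Aa; rewrite fai.
    have : delta * mdist x a <= delta * (6 / eps) by rewrite ler_pM2l// ltW.
    lra.
  have phii : phi x i = 0.
    by apply/eqP/negPn/negP => /phiU; rewrite /U/= ltNge hc.
  have ki : k x i = 0 by apply/max_idPl; rewrite subr_le0.
  by rewrite /G /normalize ki phii; ring.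
have Glip x y : \sum_i `|G x i - G y i| <= eps * mdist x y.
  apply: (le_trans (convex_combination_dist (al y) (normalize (k x)) (phi x)
    (al01 x) (khat0 y) (phi0 y) (khat1 y) (phi1 y))).
  have h1 := @normalize_lipschitz _ _ _ k _ _ N80 k0 ksum klip x y.
  have h2 := philip x y; have h3 := allip x y.
  have e1 : 2 * N * delta / (8 * N)^-1 <= eps / 3.
    rewrite invrK.
    have : delta * (48 * N ^+ 2) <= eps by rewrite -ler_pdivlMr ?mulr_gt0 ?exprn_gt0.
    by rewrite expr2; lra.
  have e2 : 2 * N / s = eps / 3 by rewrite sE; field; rewrite !gt_eqF.
  have := ler_wpM2r (mdist_ge0 x y) e1.
  by move: h1 h2; rewrite -/N e2; lra.
(* Putting [f] itself on [A] makes the extension exact; by [GA] the jump to [G] costs at most the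
   additive [eps]. *)
pose v x i := if pselect (A x) then sphere_val (f x) 0 i else G x i.
have [||| g gv] := @sphere_mapP R m X v.
- move=> x i; rewrite /v; case: pselect => [Ax|nAx] /=; first exact: sphere_coord_ge0.
  by have /andP[a0 a1] := al01 x; rewrite addr_ge0// mulr_ge0//; lra.
- move=> x; rewrite /v; case: pselect => [Ax|nAx] /=; first exact: sphere_coord_sum.
  by rewrite big_split/= -!mulr_sumr khat1 phi1; ring.
- by move=> x; rewrite /v; case: pselect => [Ax|nAx] //=; exact: sphere_coord_eq0.
have gA x i : A x -> sphere_val (g x) 0 i = sphere_val (f x) 0 i.
  by move=> Ax; rewrite gv /v; case: pselect.
have gG x i : ~ A x -> sphere_val (g x) 0 i = G x i.
  by move=> nAx; rewrite gv /v; case: pselect.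
have GA a : A a -> \sum_i `|sphere_val (f a) 0 i - G a i| <= eps.
  move=> Aa; have ala : al a = 1.
    have da : d a = 0.
      apply/eqP; rewrite eq_le d0 andbT.
      have := @mcshane_le R X A 1 (fun=> 0) a a ler01 (fun=> lexx 0) Aa.
      by rewrite mdistxx add0r mulr0.
    by rewrite /al da mulr0 subr0; apply/max_idPr.
  have f1 := sphere_coord_sum (f a).
  (* As its coordinates sum to 1, [f a] is its own normalization, so [normalize_dist] applies with
     [mu = 1]. *)
  have -> : \sum_i `|sphere_val (f a) 0 i - G a i| =
      \sum_i `|normalize (fun i => sphere_val (f a) 0 i) i - normalize (k a) i|.
    apply: eq_bigr => i _.
    rewrite [in RHS]/normalize f1 divr1.
    by rewrite /G ala mul1r subrr mul0r addr0.
  apply: (le_trans (@normalize_dist _ _ _ _ 1 _ _ _ _)) => //.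
  - by rewrite f1.
  - exact: lt_le_trans (ksum a).
  (* McShane's formula loses at most [delta <= c] on [A], and subtracting [c] loses at most another
     [c]; normalizing doubles the total, giving [4 * N * c <= eps]. *)
  have : \sum_i `|sphere_val (f a) 0 i - k a i| <= \sum_(i < m.+2) 2 * c.
    apply: ler_sum => i _; have := hge i a Aa; have := hle a i a Aa.
    rewrite mdistxx mulr0 ler_norml /k; have := sphere_coord_ge0 (f a) i.
    by rewrite maxEle; case: ifPn; rewrite -?ltNge => *; lra.
  rewrite sumr_const card_ord -[leRHS]mulr_natr -/N divr1.
  have : c * (4 * N) <= eps by rewrite -ler_pdivlMr ?mulr_gt0.
  lra.
have mixed x y : A x -> ~ A y -> mdist (g x) (g y) <= eps * mdist x y + eps.
  move=> Ax nAy; rewrite [leLHS](_ : _ = \sum_i `|sphere_val (f x) 0 i - G y i|).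
    apply: (@le_trans _ _
      (\sum_i `|sphere_val (f x) 0 i - G x i| + \sum_i `|G x i - G y i|)).
      by rewrite -big_split; apply: ler_sum => i _; exact: ler_distD.
    by rewrite addrC lerD// GA.
  by apply: eq_bigr => i _; rewrite gA// gG.
exists g; split; last first.
  by move=> x Ax; apply/val_inj/rowP => i; exact: gA.
move=> x y _ _; have [Ax|nAx] := pselect (A x); have [Ay|nAy] := pselect (A y).
- rewrite [leLHS](_ : _ = mdist (f x) (f y)); last first.
    by apply: eq_bigr => i _; rewrite !gA.
  apply: (le_trans (flip _ _ Ax Ay)).
  have deps : delta <= eps.
    apply: (le_trans deltac); apply: (le_trans ceps).
    rewrite ler_pdivrMr ?mulr_gt0// ler_peMr ?ltW//.
    have : 2 <= N by rewrite ler_nat.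
    lra.
  have := ler_wpM2r (mdist_ge0 x y) deps; lra.
- exact: mixed.
- by rewrite metric_sym (metric_sym x); exact: mixed.
- rewrite [leLHS](_ : _ = \sum_i `|G x i - G y i|); last first.
    by apply: eq_bigr => i _; rewrite !gG.
  by have := Glip x y; lra.
Qed.

(** * Choice of the constants in both directions *)

Theorem proposition5p1 (R : realType) (X : metricType R) (m : nat) :
  (forall eps : R, 0 < eps ->
     exists delta : R, [/\ 0 < delta, delta < eps &
       forall (A : set X) (f : X -> sphere R m),
         affine_lipschitz_on delta delta A f ->
         exists g : X -> sphere R m,
           affine_lipschitz eps eps g /\ (forall x, A x -> g x = f x)])
  <->
  (forall s : R, 0 < s ->
     exists t : R, s < t /\
       forall U : 'I_m.+2 -> set X,
         is_cover (range U) ->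
         (t%:E < lebesgue_number (range U))%E ->
         exists V : set (set X),
           [/\ is_refinement (range U) V,
               (s%:E < lebesgue_number V)%E &
               cover_dim_le V m]).
Proof.
set N : R := m.+2%:R; have N0 : 0 < N by rewrite ltr0n.
pose iN := N^-1; have iN0 : 0 < iN by rewrite invr_gt0.
split=> [ext s s0|refine eps eps0].
  pose eps := iN / (2 * (s + 2)).
  have eps0 : 0 < eps by rewrite divr_gt0//; lra.
  have epss : eps * (s + 2) < iN.
    rewrite [ltLHS](_ : _ = iN / 2); first by lra.
    by rewrite /eps; field; rewrite gt_eqF//; lra.
  have [delta [delta0 _ extA]] := ext eps eps0.
  have Nd : 0 < 2 * N / delta by rewrite divr_gt0// mulr_gt0.
  (* The first summand makes the partition of unity [delta]-Lipschitz; both together ensure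
     [s < t]. *)
  exists (2 * N / delta + s); split; first by lra.
  move=> U _; apply: (refinement_of_extension s0 eps0 epss delta0) extA.
    lra.
  rewrite -/N ler_pdivrMr; last by lra.
  have -> : delta * (2 * N / delta + s) = 2 * N + delta * s.
    by field; rewrite gt_eqF.
  by rewrite lerDl mulr_ge0// ltW.
pose s := 6 * N / eps; pose iN8 := (8 * N)^-1.
have s0 : 0 < s by rewrite divr_gt0// mulr_gt0.
have [t [st tP]] := refine s s0.
have t0 : 0 < t by lra.
pose c := Num.min (eps / (4 * N)) iN8.
have c0 : 0 < c by rewrite lt_min divr_gt0 ?mulr_gt0// invr_gt0 mulr_gt0.
have [ceps cN] : c <= eps / (4 * N) /\ c <= iN8.
  by rewrite !ge_min !lexx orbT.
have iN80 : 0 < iN8 by rewrite invr_gt0 mulr_gt0.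
(* One term for each bound required by [extension_of_refinement]. The halves in [c / 2] and in the
   last term yield the strict inequalities [delta < eps] and [delta * (t + 1) < iN8]. *)
pose delta := Num.min (Num.min (c / 2) (eps / (48 * N ^+ 2)))
  (Num.min (c / (6 / eps)) (iN8 / (2 * (t + 1)))).
have delta0 : 0 < delta.
  rewrite !lt_min !divr_gt0 ?mulr_gt0 ?exprn_gt0//; lra.
have [dc deps dL dt] : [/\ delta <= c / 2, delta <= eps / (48 * N ^+ 2),
    delta <= c / (6 / eps) & delta <= iN8 / (2 * (t + 1))].
  by rewrite !ge_min !lexx ?orbT.
have N2 : 2 <= N by rewrite ler_nat.
exists delta; split => //.
  apply: (@lt_le_trans _ _ c); first by lra.
  apply: (le_trans ceps).
  by rewrite ler_pdivrMr ?mulr_gt0// ler_peMr ?ltW//; lra.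
(* The infimum in [mcshane] needs a point of [A]; for empty [A] any constant map is an extension. *)
move=> A f flip; have [A0|/set0P A0] := eqVneq A set0.
  have [p _] := sphere_inhabited R m.
  exists (fun=> p); split => [x y _ _|x]; last by rewrite A0.
  by rewrite mdistxx addr_ge0 ?mulr_ge0 ?mdist_ge0// ltW.
apply: (@extension_of_refinement R X m eps c delta s t) tP A0 flip => //.
- lra.
- by rewrite -ler_pdivlMr ?divr_gt0.
- have : delta * (2 * (t + 1)) <= iN8.
    by rewrite -ler_pdivlMr ?mulr_gt0//; lra.
  by rewrite -/N -/iN8; lra.
Qed.
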